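(* For any positive integer $m$, $$\sum_{n=0}^{\infty}\frac{F_{2^{n+2}}\left[(-1)^m-1+\sum_{k=0}^{m-1}(-1)^k L_{(m-k)2^{n+2}}\right]}{F_{(2m+1)2^{n+2}}} = \frac{1}{F_{2m+1}L_{2m+1}}.$$
   Context: $F_n$ and $L_n$ denote the $n$-th Fibonacci and Lucas numbers: $F_n = \frac{\alpha^n-\beta^n}{\sqrt5}$ and $L_n=\alpha^n+\beta^n$, where $\alpha=\frac{1+\sqrt5}{2}$ and $\beta=\frac{1-\sqrt5}{2}$ (so $F_0=0$, $F_1=1$, $L_0=2$, $L_1=1$). *)

(* Defs.v *)
From mathcomp Require Import all_boot all_order all_algebra.
From mathcomp Require Import ring.
From mathcomp Require Import all_classical all_reals all_analysis.
Import Order.TTheory GRing.Theory Num.Theory numFieldNormedType.Exports.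

Set Implicit Arguments.
Unset Strict Implicit.
Unset Printing Implicit Defensive.

Local Open Scope ring_scope.

Section BinetForms.
Context {R : realType}.

Definition golden : R := (1 + Num.sqrt 5) / 2.
Definition golden_conj : R := (1 - Num.sqrt 5) / 2.

Definition fib (n : nat) : R := (golden ^+ n - golden_conj ^+ n) / Num.sqrt 5.
Definition lucas (n : nat) : R := golden ^+ n + golden_conj ^+ n.

Lemma sqr_sqrt5 : Num.sqrt 5 ^+ 2 = 5 :> R.
Proof. by rewrite sqr_sqrtr. Qed.

Lemma sqrt5_neq0 : Num.sqrt 5 != 0 :> R.
Proof. by rewrite gt_eqF // sqrtr_gt0. Qed.

Lemma golden_sqr : golden ^+ 2 = golden + 1.
Proof. by have h := sqr_sqrt5; rewrite /golden; field: h. Qed.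

Lemma golden_conj_sqr : golden_conj ^+ 2 = golden_conj + 1.
Proof. by have h := sqr_sqrt5; rewrite /golden_conj; field: h. Qed.

Lemma fib0 : fib 0 = 0.
Proof. by rewrite /fib !expr0 subrr mul0r. Qed.

Lemma fib1 : fib 1 = 1.
Proof. by rewrite /fib /golden /golden_conj; field; exact: sqrt5_neq0. Qed.

Lemma fibSS n : fib n.+2 = fib n.+1 + fib n.
Proof.
rewrite /fib -addn2 !exprD golden_sqr golden_conj_sqr !exprS.
by field; exact: sqrt5_neq0.
Qed.

Lemma lucas0 : lucas 0 = 2.
Proof. by rewrite /lucas !expr0. Qed.

Lemma lucas1 : lucas 1 = 1.
Proof. by rewrite /lucas /golden /golden_conj; field. Qed.

Lemma lucasSS n : lucas n.+2 = lucas n.+1 + lucas n.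
Proof.
by rewrite /lucas -addn2 !exprD golden_sqr golden_conj_sqr !exprS; ring.
Qed.

End BinetForms.

(* Main.v *)
Require Import Defs.
From mathcomp Require Import all_boot all_order all_algebra.
From mathcomp Require Import ring lra zify.
From mathcomp Require Import all_classical all_reals all_analysis.
Import Order.TTheory GRing.Theory Num.Theory numFieldNormedType.Exports.

Local Open Scope classical_set_scope.
Local Open Scope ring_scope.

(** Put M = 2m+1. For even h the alternating sum of Lucas numbers satisfies
    (-1)^m + sum_(k < m) (-1)^k L_{(m-k)2h} = L_{Mh} / L_h.
    With h = 2^(n+1) and the duplication formula F_{2k} = F_k L_k, the n-th term
    becomes F_h / F_{Mh} - F_{2h} / F_{M(2h)}, so the series telescopes to
    F_2 / F_{2M} = 1 / (F_M L_M); the remainder F_h / F_{Mh} is at most 1 / L_h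
    and hence tends to 0. *)

Section FibonacciLucas.
Context {R : realType}.
Local Notation F := (@fib R).
Local Notation L := (@lucas R).

Lemma golden_mul_conj : golden * golden_conj = -1 :> R.
Proof. by have h := @sqr_sqrt5 R; rewrite /golden /golden_conj; field: h. Qed.

Lemma golden_gt1 : 1 < golden :> R.
Proof.
have : 1 < Num.sqrt 5 :> R by rewrite -[ltLHS]sqrtr1 ltr_sqrt // ltr1n.
by rewrite /golden; lra.
Qed.

Lemma fib_gt0 n : (0 < n)%N -> 0 < F n.
Proof.
(* Carrying two consecutive terms makes the two-step recurrence fit plain induction. *)
suff {n} pos n : 0 <= F n /\ 0 < F n.+1 by case: n => // n _; exact: (pos n).2.
elim: n => [|n [h0 h1]]; first by rewrite fib0 fib1.
by rewrite fibSS; split; [exact: ltW | exact: ltr_wpDr].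
Qed.

Lemma fib_ge0 n : 0 <= F n.
Proof. by case: n => [|n]; [rewrite fib0 | exact/ltW/fib_gt0]. Qed.

Lemma fib_le : {homo F : m n / (m <= n)%N >-> m <= n}.
Proof.
apply: homo_leq => [x //|y x z|[|n]]; first exact: le_trans.
  by rewrite fib0 fib1.
by rewrite fibSS lerDl fib_ge0.
Qed.

Lemma fib_double k : F (2 * k) = F k * L k.
Proof. by rewrite /fib /lucas mulnC !exprM; ring. Qed.

Lemma golden_exp_le_lucas h : ~~ odd h -> golden ^+ h <= L h.
Proof. by move=> ev; rewrite lerDl exprn_even_ge0. Qed.

Lemma lucas_gt0 h : ~~ odd h -> 0 < L h.
Proof.
move=> ev; apply: lt_le_trans (golden_exp_le_lucas _ ev).
exact/exprn_gt0/(lt_trans ltr01 golden_gt1).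
Qed.

(** In the expanded product the cross terms carry the factor ([golden * golden_conj])^h = (-1)^h =
    1, so they collapse to [L n]. *)
Lemma lucas_mul_even h n : ~~ odd h ->
  L h * L (n + h) = L (n + 2 * h) + L n.
Proof.
move=> ev; have ab : golden ^+ h * golden_conj ^+ h = 1 :> R.
  by rewrite -exprMn golden_mul_conj -signr_odd (negbTE ev).
by rewrite /lucas mulnC !exprD !exprM; ring: ab.
Qed.

Lemma lucas_alternating_sum h m : ~~ odd h ->
  L h * ((-1) ^+ m + \sum_(0 <= k < m) (-1) ^+ k * L ((m - k) * (2 * h))) =
  L ((2 * m + 1) * h).
Proof.
move=> ev; elim: m => [|m IH].
  by rewrite big_nil expr0 addr0 mulr1 mul1n.
(* Splitting off k = 0 leaves the negated sum for [m]: the new bracket is L_{(m+1)2h} minus the old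
   one, and [lucas_mul_even] at index (2m+1)h applies. *)
rewrite big_nat_recl // expr0 mul1r subn0.
under eq_bigr => k _ do rewrite subSS exprS mulN1r mulNr.
rewrite sumrN exprS mulN1r.
have -> : (m.+1 * (2 * h) = (2 * m + 1) * h + h)%N by lia.
have -> : ((2 * m.+1 + 1) * h = (2 * m + 1) * h + 2 * h)%N by lia.
by have := lucas_mul_even h ((2 * m + 1) * h) ev; rewrite -IH; lra.
Qed.

(** Let B be the bracket without its -1. Duplication gives F_{2Mh} = F_{Mh} L_h B, so F_{2h} B /
    F_{2Mh} = F_h / F_{Mh}; the -1 supplies the subtracted term. *)
Lemma fib_ratio_telescope h m : (0 < h)%N -> ~~ odd h ->
  F (2 * h) *
    ((-1) ^+ m - 1 + \sum_(0 <= k < m) (-1) ^+ k * L ((m - k) * (2 * h))) /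
    F ((2 * m + 1) * (2 * h)) =
  F h / F ((2 * m + 1) * h) - F (2 * h) / F ((2 * m + 1) * (2 * h)).
Proof.
move=> h_gt0 ev; have sumE := lucas_alternating_sum h m ev.
have oddmul_gt0 : (0 < (2 * m + 1) * h)%N by rewrite muln_gt0 addn1.
have ev' : ~~ odd ((2 * m + 1) * h) by rewrite oddM negb_and ev orbT.
rewrite [in F (_ * (2 * h))]mulnCA !fib_double -sumE.
have := lucas_gt0 _ ev'; rewrite -sumE.
have := lucas_gt0 _ ev; have := fib_gt0 _ oddmul_gt0.
set S := \sum_(0 <= k < m) _; move=> F_gt0 Lh_gt0 LM_gt0.
(* [field] divides by this bracket; it is positive since its product with L_h > 0 is L_{Mh} > 0. *)
have D_gt0 : 0 < (-1) ^+ m + S by rewrite -(pmulr_rgt0 _ Lh_gt0).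
by field; rewrite !gt_eqF.
Qed.

(** Since M >= 2, monotonicity gives F_{Mh} >= F_{2h} = F_h L_h, and L_h is at least [golden ^+ h]
    for even h. *)
Lemma fib_ratio_le h m : (0 < h)%N -> ~~ odd h -> (0 < m)%N ->
  F h / F ((2 * m + 1) * h) <= golden^-1 ^+ h.
Proof.
move=> h_gt0 ev m_gt0.
have F2h : F h * L h <= F ((2 * m + 1) * h).
  by rewrite -fib_double; apply: fib_le; rewrite leq_mul2r; lia.
have gh_gt0 : 0 < golden ^+ h :> R.
  exact/exprn_gt0/(lt_trans ltr01 golden_gt1).
rewrite exprVn ler_pdivrMr; last by apply: fib_gt0; rewrite muln_gt0 addn1.
rewrite mulrC ler_pdivlMr //; apply: le_trans F2h.
by rewrite ler_pM2l ?fib_gt0 // golden_exp_le_lucas.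
Qed.

Lemma fib_ratio_cvg0 m : (0 < m)%N ->
  (fun n => F (2 ^ n.+1) / F ((2 * m + 1) * 2 ^ n.+1)) @ \oo --> (0 : R).
Proof.
move=> m_gt0; have g_gt0 : 0 < golden :> R := lt_trans ltr01 golden_gt1.
have gV_lt1 : golden^-1 < 1 :> R by rewrite invf_lt1 // golden_gt1.
apply: (@squeeze_cvgr _ _ _ _ (cst 0) (fun n => golden^-1 ^+ n)).
- near=> n; rewrite divr_ge0 ?fib_ge0 //=.
  apply: le_trans (fib_ratio_le (2 ^ n.+1) m _ _ m_gt0) _.
  + by rewrite expn_gt0.
  + by rewrite oddX.
  (* The base is at most 1, so n <= 2^(n+1) turns the bound into a plain geometric one. *)
  + apply: ler_wiXn2l; rewrite ?invr_ge0 ?ltW //.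
    exact: leq_trans (leqnSn n) (ltnW (ltn_expl _ _)).
- exact: cvg_cst.
- by apply: cvg_expr; rewrite ger0_norm // invr_ge0 ltW.
Unshelve. all: by end_near. Qed.

End FibonacciLucas.

Theorem theorem5 (R : realType) (m : nat) (hm : (0 < m)%N) :
  series (fun n : nat =>
    fib (2 ^ (n + 2))%N *
      ((-1) ^+ m - 1 +
       \sum_(0 <= k < m) (-1) ^+ k * lucas ((m - k) * 2 ^ (n + 2))%N) /
    fib ((2 * m + 1) * 2 ^ (n + 2))%N) @ \oo -->
  (1 / (fib (2 * m + 1)%N * lucas (2 * m + 1)%N) : R).
Proof.
pose u n : R := fib (2 ^ n.+1) / fib ((2 * m + 1) * 2 ^ n.+1).
have u0 : u 0%N = 1 / (fib (2 * m + 1)%N * lucas (2 * m + 1)%N).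
  by rewrite /u expn1 mulnC fib_double fibSS fib1 fib0 addr0.
rewrite -u0 -[X in _ --> X]subr0.
(* The n-th partial sum runs over k < n, so it ends at [u n]. *)
rewrite (_ : series _ = fun n => u 0%N - u n).
  by apply: cvgB; [exact: cvg_cst | exact: fib_ratio_cvg0].
apply/funext => n; rewrite /series /= -[RHS]opprB -telescope_sumr // -sumrN.
(* Writing 2^(k+2) = 2h with h = 2^(k+1) keeps h even already at k = 0. *)
apply: eq_bigr => k _; rewrite addn2 expnS fib_ratio_telescope ?expn_gt0 ?oddX //.
by rewrite opprB.
Qed.
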